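(* Let $C_1: f_1=0$ be a reduced curve of degree $d_1$ in $\mathbb{P}^2$, where $f_1\in S=\mathbb{C}[x,y,z]$ is homogeneous, let $r_1=mdr(f_1)$, and let $(a_1,b_1,c_1)\in AR(f_1)_{r_1}$ be a non-zero Jacobian syzygy of minimal degree, i.e. $a_1,b_1,c_1\in S_{r_1}$ are not all zero and $a_1 f_{1x}+b_1f_{1y}+c_1f_{1z}=0$. Let $u=(s:t)\in\mathbb{P}^1$ and let $L_u: sy+tz=0$ be the corresponding line through the point $p=(1:0:0)$ (the point $p$ may or may not lie on $C_1$); assume $L_u$ is not an irreducible component of $C_1$. Let $C=C_1\cup L_u: f=(sy+tz)f_1=0$, let $r=mdr(f)$, and let $r=d_1'(f)\le d_2'(f)\le\dots\le d_m'(f)$ be the degrees of a minimal set of homogeneous generators of the graded $S$-module $AR(f)$. If $sy+tz$ is a factor of $sb_1+tc_1$, then $r=r_1$. If $sy+tz$ is not a factor of $sb_1+tc_1$, then either (1) $r=r_1+1$, or (2) $r=r_1$ and $d_2'(f)\le r+1$. Moreover, the case (2) is impossible when $2r_1<d_1-1$, or when $2r_1=d_1-1$ and $C$ is not free.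
   Context: $S=\mathbb{C}[x,y,z]$ with its standard grading. For a homogeneous polynomial $g\in S$ write $g_x,g_y,g_z$ for its partial derivatives and $AR(g)=\{(a,b,c)\in S^3: ag_x+bg_y+cg_z=0\}$, the graded $S$-module of Jacobian syzygies of $g$; $AR(g)_s$ consists of the triples with $a,b,c\in S_s$. The minimal degree of a Jacobian syzygy is $mdr(g)=\min\{s\in\mathbb{N}: AR(g)_s\neq 0\}$. The curve $C_g:g=0$ is called free if $AR(g)$ is a free graded $S$-module. *)

(* Defs.v *)
From HB Require Import structures.
From mathcomp Require Import all_boot all_order all_algebra.
From mathcomp Require Import complex reals mpoly.

Set Implicit Arguments.
Unset Strict Implicit.
Unset Printing Implicit Defensive.

Import GRing.Theory.

Local Open Scope ring_scope.

Definition ix : 'I_3 := @Ordinal 3 0 isT.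
Definition iy : 'I_3 := @Ordinal 3 1 isT.
Definition iz : 'I_3 := @Ordinal 3 2 isT.

Section Syzygies.
Variable K : fieldType.
Local Notation S := {mpoly K[3]}.

Definition triple (a b c : S) : 'rV[S]_3 := \row_i nth 0 [:: a; b; c] i.

Definition divides (p q : S) : Prop := exists h : S, q = h * p.

Definition squarefree (g : S) : Prop :=
  g != 0 /\ forall h : S, divides (h ^+ 2) g -> h \is a GRing.unit.

(* For g homogeneous of degree d > 0, the plane curve g = 0 is reduced iff
   g has no multiple factor. *)
Definition reduced_curve (d : nat) (g : S) : Prop :=
  [/\ (0 < d)%N, g \is d.-homog & squarefree g].

Definition AR (g : S) (v : 'rV[S]_3) : Prop :=
  v 0 ix * mderiv ix g + v 0 iy * mderiv iy g + v 0 iz * mderiv iz g = 0.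

(* The zero triple belongs to AR_deg g k for every k, since 0 \is k.-homog. *)
Definition AR_deg (g : S) (k : nat) (v : 'rV[S]_3) : Prop :=
  AR g v /\ forall i, v 0 i \is k.-homog.

(* "mdr g = r"; such an r exists and is unique, because AR g always contains
   a nonzero homogeneous triple when g is homogeneous. *)
Definition is_mdr (g : S) (r : nat) : Prop :=
  (exists2 v, AR_deg g r v & v != 0) /\
  (forall k v, AR_deg g k v -> v != 0 -> (r <= k)%N).

Definition generates_AR (g : S) (m : nat) (e : 'I_m -> 'rV[S]_3)
    (J : {set 'I_m}) : Prop :=
  forall v, AR g v -> exists q : 'I_m -> S, v = \sum_(i in J) q i *: e i.

(* ds lists, in nondecreasing order and with multiplicities, the degrees
   d'_1 <= ... <= d'_m of a minimal set of homogeneous generators of AR g;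
   d'_k is nth 0 ds k.-1.  By minimality no generator is 0, so each generator
   has a well-defined degree. *)
Definition min_gen_degrees (g : S) (ds : seq nat) : Prop :=
  sorted leq ds /\
  exists e : 'I_(size ds) -> 'rV[S]_3,
    [/\ forall i : 'I_(size ds), AR_deg g (nth 0%N ds i) (e i),
        generates_AR g e setT
      & forall J : {set 'I_(size ds)}, generates_AR g e J -> J = setT].

(* AR g has a homogeneous S-basis, i.e. it is a free graded S-module. *)
Definition free_curve (g : S) : Prop :=
  exists (m : nat) (ds : 'I_m -> nat) (e : 'I_m -> 'rV[S]_3),
    [/\ forall i, AR_deg g (ds i) (e i),
        generates_AR g e setT
      & forall q : 'I_m -> S, \sum_i q i *: e i = 0 -> forall i, q i = 0].

(* The form s y + t z defining the line L_(s:t) through (1:0:0). *)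
Definition line (s t : K) : S := s *: 'X_iy + t *: 'X_iz.

End Syzygies.

(* Main.v *)
(* Regard a triple v as the vector field v_x d/dx + v_y d/dy + v_z d/dz, let E be
   the Euler field and f = l f1. As the prime l does not divide f1, a field maps f
   into (f) exactly when it maps f1 into (f1) and l into (l); subtracting the
   right multiple of E turns such a field into a syzygy. Hence AR(f) is isomorphic to {v in AR(f1) : l | v(l)},
   which contains l AR(f1), so that r1 <= r <= r1 + 1.

   Let v1 be the given syzygy, l not dividing v1(l), and suppose r = r1, with
   v in AR(f) of degree r. The syzygy w of f of degree r + 1 coming from l v1 is
   not dependent on v: otherwise, by unique factorization and minimality of r1,
   v1 would be a multiple of the syzygy of f1 coming from v, and l would divide
   v1(l). So one generator of degree <= r + 1 is not enough. Moreover
   det(E, w, v) is nonzero, has degree 2 r1 + 2, and is divisible by the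
   squarefree f of degree d1 + 1, whence 2 r1 >= d1 - 1; in case of equality it
   is a nonzero constant times f and Saito's criterion says that C is free. *)

From mathcomp Require Import all_boot all_order all_algebra.
From mathcomp Require Import boolp complex reals mpoly.
From mathcomp Require Import ring zify.
Require Import Defs.

Set Implicit Arguments.
Unset Strict Implicit.
Unset Printing Implicit Defensive.

Import GRing.Theory Num.Theory.

Local Open Scope ring_scope.

(** * Unique factorization in polynomial rings *)

Section Divisibility.
Variable R : idomainType.
Implicit Types a b c p q : R.

Definition rdvd a b := exists h, b = h * a.

Definition irred q :=
  [/\ q != 0, q \isn't a GRing.unit
    & forall a b, q = a * b -> a \is a GRing.unit \/ b \is a GRing.unit].

Definition prime_elt p :=
  [/\ p != 0, p \isn't a GRing.unit
    & forall a b, rdvd p (a * b) -> rdvd p a \/ rdvd p b].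

(** Asking for prime rather than irreducible factors builds uniqueness of the factorization into its
    existence. *)
Definition factorial_ring :=
  forall c, c != 0 -> exists (u : R) (s : seq R),
    [/\ u \is a GRing.unit, forall p, p \in s -> prime_elt p
      & c = u * \prod_(p <- s) p].

Lemma rdvdB a b c : rdvd a b -> rdvd a c -> rdvd a (b - c).
Proof. by case=> x -> [y ->]; exists (x - y); rewrite mulrBl. Qed.

Lemma prime_factor c : factorial_ring -> c != 0 -> c \isn't a GRing.unit ->
  exists2 p, prime_elt p & rdvd p c.
Proof.
move=> facR c0; have [u [[|p s] [uU sP ->]]] := facR c c0.
  by rewrite big_nil mulr1 uU.
exists p; first by apply: sP; rewrite mem_head.
by exists (u * \prod_(j <- s) j); rewrite big_cons; ring.
Qed.

Lemma irred_prime q : factorial_ring -> irred q -> prime_elt q.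
Proof.
move=> facR [q0 qU qirr]; have [p [p0 pU pP] [h hE]] := prime_factor facR q0 qU.
split=> // a b [k kE].
have hU : h \is a GRing.unit by case: (qirr _ _ hE) => // pU'; rewrite pU' in pU.
have lift c : rdvd p c -> rdvd q c.
  by case=> m ->; exists (m / h); rewrite hE mulrA divrK.
by case: (pP a b) => [|/lift|/lift]; [exists (k * h); rewrite kE hE mulrA | left | right].
Qed.

End Divisibility.

(** * Gauss's lemma for univariate polynomials *)

Section Gauss.
Import Pdiv.Idomain.
Variable R : idomainType.
Implicit Types (p q a b : {poly R}) (c : R).

(** Induction on the sum of the sizes: [c] divides the product of the leading coefficients, hence
    one of them, and that leading term can be removed. *)
Lemma prime_polyC c : prime_elt c -> prime_elt c%:P.
Proof.
move=> [c0 cU cP]; split; rewrite ?polyC_eq0 //.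
  by rewrite poly_unitE coefC eqxx (negbTE cU) andbF.
suff IH n (a b : {poly R}) : (size a + size b < n)%N ->
    rdvd c%:P (a * b) -> rdvd c%:P a \/ rdvd c%:P b.
  by move=> a b; apply: (IH (size a + size b).+1).
elim: n a b => // n IHn a b.
rewrite ltnS => le_n [h hE].
have [->|a0] := eqVneq a 0; first by left; exists 0; rewrite mul0r.
have [->|b0] := eqVneq b 0; first by right; exists 0; rewrite mul0r.
have drop_lead (p : {poly R}) : p != 0 -> rdvd c (lead_coef p) ->
    exists2 p' : {poly R}, (size p' < size p)%N & rdvd c%:P (p - p').
  move=> p0 [k kE]; exists (p - lead_coef p *: 'X^((size p).-1)).
    rewrite (polySpred p0) ltnS; apply/leq_sizeP => j.
    rewrite leq_eqVlt => /predU1P[<-|ltj].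
      by rewrite coefB coefZ coefXn eqxx mulr1 lead_coefE subrr.
    rewrite coefB coefZ coefXn (gtn_eqF ltj) mulr0 subr0 nth_default //.
    by rewrite (polySpred p0).
  exists (k *: 'X^((size p).-1)).
  by rewrite opprB addrC subrK kE -!mul_polyC polyCM; ring.
have /cP[/(drop_lead a a0)|/(drop_lead b b0)] : rdvd c (lead_coef a * lead_coef b).
- exists (h`_(size a + size b).-2).
  by rewrite -lead_coefM lead_coefE size_mul // hE coefMC.
- case=> a' lta [k kE]; have aE : a = a' + k * c%:P by rewrite -kE; ring.
  have [||[m mE]|] := IHn a' b; last by right.
  + by rewrite (leq_trans _ le_n) // ltn_add2r.
  + by exists (h - k * b); rewrite mulrBl -hE aE; ring.
  by left; exists (m + k); rewrite aE mE mulrDl.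
- case=> b' ltb [k kE]; have bE : b = b' + k * c%:P by rewrite -kE; ring.
  have [||  |[m mE]] := IHn a b'; last 1 first.
  + by right; exists (m + k); rewrite bE mE mulrDl.
  + by rewrite (leq_trans _ le_n) // ltn_add2l.
  + by exists (h - k * a); rewrite mulrBl -hE bE; ring.
  by left.
Qed.

Hypothesis facR : factorial_ring R.

(** The prime factors of [c] are cancelled one at a time: each stays prime in [{poly R}], so it
    divides [g] or [h]. The constants [x] and [y] collect what leaves either side. *)
Lemma clear_denominator c (a g h : {poly R}) : c != 0 -> c *: a = g * h ->
  exists (g' h' : {poly R}) (x y : R), [/\ a = g' * h', g = x *: g' & h = y *: h'].
Proof.
move/facR=> [u [s [uU sP ->]]].
elim: s sP a g h => [_|p s IHs sP] a g h.
  rewrite big_nil mulr1 => aE.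
  exists (u^-1 *: g), h, u, 1; split; rewrite ?scale1r ?scalerA ?divrr ?mulrV ?scale1r //.
  by rewrite -scalerAl -aE scalerA mulVr // scale1r.
rewrite big_cons mulrCA -scalerA => aE.
have [p0 pU _] : prime_elt p by apply: sP; rewrite mem_head.
have [_ _ pP] : prime_elt p%:P by apply/prime_polyC/sP; rewrite mem_head.
have {}sP (q : R) : q \in s -> prime_elt q by move=> qs; apply: sP; rewrite inE qs orbT.
have pI : injective (fun x => p *: x : {poly R}).
  by move=> x y /=; rewrite -!mul_polyC; apply: mulfI; rewrite polyC_eq0.
have [|[k gE]|[k hE]] := pP g h.
- by rewrite -aE -mul_polyC mulrC; eexists.
- have {}aE : (u * \prod_(q <- s) q) *: a = k * h.
    by apply: pI; rewrite /= aE gE -!mul_polyC; ring.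
  have [g' [h' [x [y [-> kE ->]]]]] := IHs sP _ _ _ aE.
  exists g', h', (p * x), y; split=> //.
  by rewrite gE kE -!mul_polyC polyCM; ring.
have {}aE : (u * \prod_(q <- s) q) *: a = g * k.
  by apply: pI; rewrite /= aE hE -!mul_polyC; ring.
have [g' [h' [x [y [-> -> kE]]]]] := IHs sP _ _ _ aE.
exists g', h', x, (p * y); split=> //.
by rewrite hE kE -!mul_polyC polyCM; ring.
Qed.

Lemma unit_polyC c : (c%:P \is a GRing.unit) = (c \is a GRing.unit).
Proof.
rewrite poly_unitE coefC size_polyC /=.
by have [->|] := eqVneq c 0; rewrite ?unitr0.
Qed.

(* [%|] on [{poly R}] is divisibility up to nonzero constants, i.e. over the
   fraction field of [R]; an irreducible [q] of positive degree has no constant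
   factor, so there it agrees with divisibility in [{poly R}]. *)
Lemma irred_poly_prime (q : {poly R}) : irred q -> prime_elt q.
Proof.
move=> [q0 qU qirr].
have [szq|szq] := leqP (size q) 1.
  have [c qE] : exists c, q = c%:P by exists q`_0; apply: size1_polyC.
  rewrite qE; apply/prime_polyC/irred_prime => //; split.
  - by apply: contraNneq q0 => c0; rewrite qE c0.
  - by rewrite -unit_polyC -qE.
  by move=> x y cE; rewrite -!unit_polyC; apply: qirr; rewrite qE cE polyCM.
have size_scale (y : R) (p : {poly R}) : p \is a GRing.unit -> (size (y *: p) <= 1)%N.
  by rewrite poly_unitE => /andP[/eqP szp _]; rewrite (leq_trans (size_scale_leq _ _)) // szp.
(* Clearing the denominator gives [b = b' * q'] with [q = y *: q']; as [q] is irreducible of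
   positive degree, [y] is a unit. *)
have dvd_true (b : {poly R}) : q %| b -> rdvd q b.
  case/dvdpP => -[c k] /= c0 /(clear_denominator c0)[b' [q' [x [y [bE _ qE]]]]].
  have [|yU|q'U] := qirr y%:P q'; first by rewrite mul_polyC.
    have {}yU : y \is a GRing.unit by rewrite -unit_polyC.
    by exists (y^-1 *: b'); rewrite qE bE -!mul_polyC mulrACA -polyCM mulVr // mul1r.
  by move: szq; rewrite qE ltnNge size_scale.
split=> // a b [h /(congr1 (fun p : {poly R} => q %| p))]; rewrite dvdp_mulIr => qab.
have [cop|ncop] := boolP (coprimep q a).
  by right; apply: dvd_true; move: qab; rewrite Gauss_dvdpr.
(* The gcd of [q] and [a] is not constant, so irreducibility makes it equal to [q] up to
   constants. *)
left; apply: dvd_true; apply: dvdp_trans (dvdp_gcdr q a).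
have := dvdp_gcdl q a.
case/dvdpP => -[c k] /= c0 /(clear_denominator c0)[k' [g [x [y [qE _ gE]]]]].
have [//|k'U|gU] := qirr k' g.
  apply/dvdpP; exists (1, y%:P * k'^-1); rewrite ?oner_eq0 //=.
  by rewrite scale1r gE qE -mulrA mulKr // mul_polyC.
case/negP: ncop; rewrite coprimep_def eqn_leq {1}gE size_scale //=.
by rewrite size_poly_gt0 gcdp_eq0 negb_and q0.
Qed.

End Gauss.

Lemma irred_prime_iso (R S : idomainType) (f : {rmorphism R -> S}) (g : S -> R) :
  injective f -> cancel g f ->
  (forall q : S, irred q -> prime_elt q) -> forall q : R, irred q -> prime_elt q.
Proof.
move=> fI gK primeS q [q0 qU qirr].
have unit_f x : (f x \is a GRing.unit) = (x \is a GRing.unit).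
  apply/idP/idP => [/unitrPr[y xy1]|]; last exact: rmorph_unit.
  by apply/unitrPr; exists (g y); apply: fI; rewrite rmorphM rmorph1 gK.
have f_dvd x y : rdvd (f x) (f y) -> rdvd x y.
  by case=> h hE; exists (g h); apply: fI; rewrite rmorphM gK.
have [|_ _ fqP] := primeS (f q).
  split; rewrite ?unit_f // -?(rmorph0 f) ?(inj_eq fI) //.
  move=> a b qE; rewrite -[a]gK -[b]gK !unit_f; apply: qirr.
  by apply: fI; rewrite qE rmorphM !gK.
split=> // a b [h hE].
have /fqP[/f_dvd|/f_dvd] : rdvd (f q) (f a * f b); [|by left|by right].
by exists (f h); rewrite -!rmorphM hE.
Qed.

(** * Unique factorization in several variables *)

Section MPolyFactorial.
Local Notation widen := (widen_ord (leqnSn _)).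
Variable K : fieldType.

Lemma muni_mwiden n (c : {mpoly K[n]}) : muni (mwiden c) = c%:P.
Proof.
have widen_sum : mwiden c = \sum_(m <- msupp c) mwiden (c@_m *: 'X_[m]).
  by rewrite [in LHS](mpolyE c) (raddf_sum (@mwiden n K)).
rewrite widen_sum [in RHS](mpolyE c) (raddf_sum (@muni n K)) raddf_sum /=.
apply: eq_bigr => m _.
rewrite mwidenZ mwidenX muniZ muniE msuppX big_seq1 mcoeffX eqxx scale1r.
rewrite mnmwiden_ordmax expr0 alg_polyC -mul_polyC -polyCM mul_mpolyC.
by congr (_ *: 'X_[_])%:P; apply/mnmP => i; rewrite mnmE mnmwiden_widen.
Qed.

Lemma muni_Xmax n : muni ('X_ord_max : {mpoly K[n.+1]}) = 'X.
Proof.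
rewrite muniE msuppX big_seq1 mcoeffX eqxx scale1r mnm1E eqxx expr1.
rewrite (_ : [multinom _ | i < n] = 0%MM) ?mpolyX0 ?scale1r //.
apply/mnmP => i; rewrite mnmE mnm0E mnm1E -val_eqE /= gtn_eqF //.
Qed.

Lemma mmultiK n : cancel (@mmulti n K) (@muni n K).
Proof.
move=> p; rewrite /mmulti raddf_sum /= -[RHS]coefK poly_def.
by apply: eq_bigr => i _; rewrite rmorphM rmorphXn /= muni_Xmax muni_mwiden mul_polyC.
Qed.

Lemma muni_inj n : injective (@muni n K).
Proof.
move=> p q pq.
(* A monomial is determined by its exponent in the last variable and the remaining exponents, so
   each coefficient of [r] can be read off [muni r]. *)
suff coefE (r : {mpoly K[n.+1]}) m :
    r@_m = (muni r)`_(m ord_max)@_[multinom (m (widen i)) | i < n].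
  by apply/mpolyP => m; rewrite !coefE pq.
rewrite muniE coef_sum raddf_sum /= [in LHS](mpolyE r) raddf_sum /=.
apply: eq_bigr => m1 _; rewrite !coefZ coefXn mulr_natr mcoeffMn !mcoeffZ !mcoeffX.
rewrite -mulrnAr -mulrnA mulnb; congr (_ * (nat_of_bool _)%:R).
apply/idP/idP => [/eqP ->|/andP[/eqP/mnmP eqw /eqP eqm]]; first by rewrite !eqxx.
apply/eqP/mnmP => i; case: (unliftP ord_max i) => [j ->|->]; last by rewrite eqm.
have -> : lift ord_max j = widen j.
  by apply/val_inj; rewrite /= /bump leqNgt ltn_ord.
by have := eqw j; rewrite !mnmE.
Qed.

Lemma unit_msize n (p : {mpoly K[n]}) : p != 0 ->
  (p \is a GRing.unit) = (msize p == 1%N).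
Proof.
move=> p0; apply/idP/idP => [/unitrPr[q pq1]|].
  have q0 : q != 0 by apply: contra_eq_neq pq1 => ->; rewrite mulr0 eq_sym oner_neq0.
  have := msizeM p0 q0; rewrite pq1 msize1 (mpolySpred _ p0) (mpolySpred _ q0).
  by rewrite addnS /= => /eqP; lia.
by case/msize_poly1P => c c0 ->; rewrite rmorph_unit // unitfE.
Qed.

(** Induction on the degree: a reducible nonunit is a product of two factors of smaller degree. *)
Lemma irred_factorial n :
  (forall q : {mpoly K[n]}, irred q -> prime_elt q) -> factorial_ring {mpoly K[n]}.
Proof.
move=> primeP c; have [k] := ubnP (msize c); elim: k c => // k IHk c.
rewrite ltnS => le_ck c0.
have [cU|cU] := boolP (c \is a GRing.unit).
  by exists c, [::]; split=> //; rewrite big_nil mulr1.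
have [c_irr|] := pselect (irred c).
  exists 1, [:: c]; split; rewrite ?unitr1 ?big_seq1 ?mul1r // => p.
  by rewrite inE => /eqP ->; apply: primeP.
move=> Nirr; suff [a [b [cE aU bU]]] :
    exists a b, [/\ c = a * b, a \isn't a GRing.unit & b \isn't a GRing.unit].
  have [a0 b0] : a != 0 /\ b != 0 by apply/andP; rewrite -negb_or -mulf_eq0 -cE.
  have := msizeM a0 b0; rewrite -cE => szc.
  have /andP[lta ltb] : (msize a < k)%N && (msize b < k)%N.
    move: le_ck aU bU; rewrite !unit_msize // szc (mpolySpred _ a0) (mpolySpred _ b0).
    by rewrite !eqSS; lia.
  have [u [s [uU sP aE]]] := IHk a lta a0.
  have [v [t [vU tP bE]]] := IHk b ltb b0.
  exists (u * v), (s ++ t); split; rewrite ?unitrM ?uU //.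
    by move=> p; rewrite mem_cat => /orP[/sP|/tP].
  by rewrite cE aE bE big_cat /=; ring.
apply: contrapT => Nab; apply: Nirr; split=> // a b cE.
have [aU|aU] := boolP (a \is a GRing.unit); first by left.
by right; apply: contrapT => /negP bU; apply: Nab; exists a, b.
Qed.

(** Induction on the number of variables: without variables every nonzero element is a unit, and
    [muni] singles out the last variable so that Gauss's lemma applies. *)
Lemma mpoly_factorial n : factorial_ring {mpoly K[n]}.
Proof.
elim: n => [|n IHn]; apply: irred_factorial => q.
  have qE : q = (q@_0)%:MP.
    apply/mpolyP => m; have -> : m = 0%MM by apply/mnmP; case.
    by rewrite mcoeffC eqxx mulr1.
  case; rewrite {1 2}qE mpolyC_eq0 => q0 /negP[].
  by rewrite rmorph_unit // unitfE.
apply: (irred_prime_iso (@muni_inj n) (@mmultiK n)).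
exact: irred_poly_prime.
Qed.

End MPolyFactorial.

(** * Derivatives and homogeneous parts *)

Section HomogeneousParts.
Variables (K : fieldType) (n : nat).
Implicit Types p q : {mpoly K[n]}.

Lemma msize_homog p d : p != 0 -> p \is d.-homog -> msize p = d.+1.
Proof.
move=> p0 hp; rewrite (mpolySpred _ p0); congr _.+1.
exact: dhomog_uniq p0 (dhomog_msize hp) hp.
Qed.

Lemma pihomogM d k p q : p \is d.-homog ->
  pihomog mdeg k (q * p) = if (d <= k)%N then pihomog mdeg (k - d) q * p else 0.
Proof.
move=> hp; have part (e : nat) : pihomog mdeg k (pihomog mdeg e q * p) =
    if (e + d == k)%N then pihomog mdeg e q * p else 0.
  have hqp : pihomog mdeg e q * p \is (e + d).-homog.
    exact: dhomogM (pihomogP _ _ _) hp.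
  by case: eqP => [<-|/eqP ne]; [rewrite pihomog_dE | rewrite (pihomog_ne0 ne)].
(* The summation range has to contain all degrees of [q] and also the index [k - d]. *)
have sz : (mmeasure mdeg q <= (msize q + k).+1)%N by lia.
rewrite {1}(pihomog_partitionE sz) mulr_suml raddf_sum /=.
under eq_bigr do rewrite part.
case: leqP => [le_dk|lt_kd]; last first.
  by apply: big1 => e _; rewrite gtn_eqF //; lia.
have lt_kd : (k - d < (msize q + k).+1)%N by lia.
rewrite (bigD1 (Ordinal lt_kd)) //= subnK // eqxx big1 ?addr0 // => e ne.
by case: eqP => // ek; case/eqP: ne; apply: val_inj => /=; lia.
Qed.

Lemma dhomog_mderiv d i p : p \is d.-homog -> mderiv i p \is d.-1.-homog.
Proof.
move/dhomogP => hp; rewrite /mderiv big_seq rpred_sum // => m /hp /= dm.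
have [mi0|mi] := eqVneq (m i) 0%N; first by rewrite mi0 mul0r scale0r rpred0.
have le_m : (U_(i) <= m)%MM.
  by apply/mnm_lepP => j; rewrite mnm1E; case: eqP => // <-; rewrite lt0n.
apply/rpredZ; rewrite dhomogX -dm -{2}(submK le_m) mdegD mdeg1.
by rewrite addn1.
Qed.

Lemma euler_identity d p : p \is d.-homog ->
  \sum_i 'X_i * mderiv i p = d%:R * p.
Proof.
move=> /dhomogP hp; rewrite [in RHS](mpolyE p) mulr_sumr.
under eq_bigr do rewrite /mderiv mulr_sumr.
rewrite exchange_big /= big_seq [in RHS]big_seq; apply: eq_bigr => m /hp /= dm.
rewrite -dm mdegE natr_sum mulr_suml; apply: eq_bigr => i _.
have [->|mi] := eqVneq (m i) 0%N; first by rewrite !mul0r scale0r mulr0.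
rewrite -mpolyC_nat mul_mpolyC scalerA -scalerAr -mpolyXD.
rewrite addmC submK //.
by apply/mnm_lepP => j; rewrite mnm1E; case: eqP => // <-; rewrite lt0n.
Qed.

End HomogeneousParts.

(** * Derivatives in characteristic zero *)

Section Derivatives.
Variables (K : numFieldType) (n : nat).
Implicit Types p q g : {mpoly K[n]}.

Lemma msize_mderiv i p : mderiv i p != 0 -> (msize (mderiv i p) < msize p)%N.
Proof.
move=> dp0; rewrite -(mlead_deg dp0).
have : (mderiv i p)@_(mlead (mderiv i p)) != 0 by rewrite mleadc_eq0.
rewrite mcoeff_deriv => cf; have {cf} : p@_(mlead (mderiv i p) + U_(i)) != 0.
  by apply: contra_neq cf => ->; rewrite mul0rn.
by rewrite -mcoeff_msupp => /msize_mdeg_lt; rewrite mdegD mdeg1 addn1.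
Qed.

Lemma mderiv_eq0_const p : (forall i, mderiv i p = 0) -> p = (p@_0)%:MP.
Proof.
move=> dp; apply/mpolyP => m; rewrite mcoeffC.
have [->|m0] := eqVneq m 0%MM; rewrite ?mulr1 // mulr0.
have [i mi] : exists i, m i != 0%N.
  apply/existsP; apply: contraNT m0 => /existsPn m0; apply/eqP/mnmP => i.
  by rewrite mnm0E; apply/eqP; rewrite -[_ == _]negbK m0.
have /mpolyP/(_ (m - U_(i))%MM) := dp i; rewrite mcoeff_deriv mcoeff0 submK.
  by move/eqP; rewrite mulrn_eq0 /= => /eqP.
by apply/mnm_lepP => j; rewrite mnm1E; case: eqP => // <-; rewrite lt0n.
Qed.

(** A partial derivative divisible by [p] vanishes for degree reasons; if all vanish, [p] is a
    constant in characteristic zero. *)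
Lemma prime_mderiv p : prime_elt p -> exists i, ~ rdvd p (mderiv i p).
Proof.
move=> [p0 /negP pU _]; apply: contrapT => dvd; apply: pU.
have dp i : mderiv i p = 0.
  apply: contrapT => /eqP dp0; apply: dvd; exists i => -[h hE].
  have := msize_mderiv dp0; rewrite hE msizeM //; last first.
    by apply: contra_neq dp0; rewrite hE => ->; rewrite mul0r.
  have h0 : h != 0 by apply: contra_neq dp0; rewrite hE => ->; rewrite mul0r.
  by rewrite (mpolySpred _ h0) addSn /= ltnNge leq_addl.
move: p0; rewrite (mderiv_eq0_const dp) mpolyC_eq0 => c0.
by rewrite rmorph_unit // unitfE.
Qed.

(* Prime by prime: a prime factor [p] of [g] cannot divide all the partial
   derivatives of [g], since [p ^+ 2] does not divide [g]. *)
Lemma squarefree_rdvd g w : g != 0 ->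
  (forall p, prime_elt p -> ~ rdvd (p ^+ 2) g) ->
  (forall i, rdvd g (w * mderiv i g)) -> rdvd g w.
Proof.
move=> g0 sqf dvd; have [u [s [uU sP gE]]] := @mpoly_factorial K n g g0.
suff: rdvd (u * \prod_(p <- s) p) w by rewrite -gE.
have : rdvd (u * \prod_(p <- s) p) g by rewrite -gE; exists 1; rewrite mul1r.
elim: s sP {gE} => [_ _|p s IHs sP [k gE]].
  by exists (w * u^-1); rewrite big_nil mulr1 divrK.
have [w' wE] : rdvd (u * \prod_(q <- s) q) w.
  apply: IHs => [q qs|]; first by apply: sP; rewrite inE qs orbT.
  by exists (k * p); rewrite gE big_cons; ring.
have pprime : prime_elt p by apply: sP; rewrite mem_head.
have [_ _ pP] := pprime.
have s0 : u * \prod_(q <- s) q != 0.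
  by apply: contraNneq g0 => s0; rewrite gE big_cons (mulrCA u) s0 !mulr0.
have [[h w'E]|Nw'] := pselect (rdvd p w').
  by exists h; rewrite wE w'E big_cons; ring.
have pg i : rdvd p (mderiv i g).
  have [h hE] := dvd i; have [|/Nw'|//] := pP w' (mderiv i g); last by [].
  exists (h * k); apply: (mulfI s0).
  by rewrite mulrA [_ * w']mulrC -wE hE {1}gE big_cons; ring.
have [m mE] : rdvd p g by exists (k * (u * \prod_(q <- s) q)); rewrite gE big_cons; ring.
have [j Npj] := prime_mderiv pprime.
(* The product rule for [g = m * p]. As [p] does not divide its [j]-th derivative, it divides [m],
   so [p ^+ 2] divides [g]. *)
have : rdvd p (m * mderiv j p).
  rewrite (_ : _ * _ = mderiv j g - mderiv j m * p); last by rewrite mE mderivM; ring.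
  by apply: rdvdB (pg j) _; exists (mderiv j m).
case/pP => // -[m' m'E]; case: (sqf p pprime).
by exists m'; rewrite mE m'E; ring.
Qed.

End Derivatives.

(** * Jacobian syzygies *)

Lemma ord3P (i : 'I_3) : [\/ i = ix, i = iy | i = iz].
Proof.
by case: i => -[|[|[|//]]] h; [constructor 1|constructor 2|constructor 3]; apply: val_inj.
Qed.

Lemma ord3_ind (P : 'I_3 -> Prop) : P ix -> P iy -> P iz -> forall i, P i.
Proof. by move=> Px Py Pz i; case: (ord3P i) => ->. Qed.

Lemma big_ord3 (V : nmodType) (F : 'I_3 -> V) : \sum_i F i = F ix + F iy + F iz.
Proof.
rewrite !big_ord_recl big_ord0 addr0 addrA.
by congr (_ + _ + _); congr F; apply: val_inj.
Qed.

Section JacobianSyzygies.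
Variable K : numFieldType.
Local Notation S := {mpoly K[3]}.
Implicit Types (g a b p q k : S) (u v w : 'rV[S]_3).

Definition along v g : S :=
  v 0 ix * mderiv ix g + v 0 iy * mderiv iy g + v 0 iz * mderiv iz g.

Lemma ARE g v : AR g v = (along v g = 0).
Proof. by []. Qed.

Definition euler : 'rV[S]_3 := \row_i 'X_i.

Definition cross u v : 'rV[S]_3 :=
  triple (u 0 iy * v 0 iz - u 0 iz * v 0 iy)
         (u 0 iz * v 0 ix - u 0 ix * v 0 iz)
         (u 0 ix * v 0 iy - u 0 iy * v 0 ix).

(** The determinant with rows [u], [v], [w]. *)
Definition triple_product u v w : S :=
  u 0 ix * cross v w 0 ix + u 0 iy * cross v w 0 iy + u 0 iz * cross v w 0 iz.

Lemma along_lin a b u v g :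
  along (a *: u + b *: v) g = a * along u g + b * along v g.
Proof. by rewrite /along !mxE; ring. Qed.

Lemma along_euler d g : g \is d.-homog -> along euler g = d%:R * g.
Proof. by move/euler_identity => <-; rewrite big_ord3 /along !mxE. Qed.

Lemma along_mul v a g : along v (a * g) = along v a * g + a * along v g.
Proof. by rewrite /along !mderivM; ring. Qed.

Lemma nonzero_entry v : v != 0 -> exists i, v 0 i != 0.
Proof.
move=> v0; apply: contrapT => Nv; case/negP: v0; apply/eqP/rowP => i.
by rewrite mxE; apply: contrapT => /eqP vi; apply: Nv; exists i.
Qed.

(** All partial derivatives of [g] are homogeneous of the same degree, so the relation splits degree
    by degree. *)
Lemma AR_pihomog d (k : nat) g v : g \is d.-homog -> AR g v ->
  AR g (map_mx (pihomog mdeg k) v).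
Proof.
move=> hg gv; have := congr1 (pihomog mdeg (k + d.-1)) gv.
rewrite !raddfD raddf0 /= !(pihomogM _ _ (dhomog_mderiv _ hg)).
by rewrite leq_addl addnK /AR !mxE.
Qed.

(** This extends minimality to syzygies not known to be homogeneous: a nonzero homogeneous part of
    the entry belongs to a homogeneous syzygy. *)
Lemma mdr_lt_msize d r g v i : g \is d.-homog -> is_mdr g r -> AR g v ->
  v 0 i != 0 -> (r < msize (v 0%R i))%N.
Proof.
move=> hg [_ minr] gv vi0.
have [k vk0] : exists k : 'I_(msize (v 0 i)), pihomog mdeg k (v 0 i) != 0.
  apply/existsP; apply: contraNT vi0 => /existsPn vk.
  rewrite (pihomog_partitionE (leqnn (msize (v 0 i)))) big1 // => k _.
  by apply/eqP; rewrite -[_ == _]negbK vk.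
apply: leq_ltn_trans (ltn_ord k).
apply: (minr k (map_mx (pihomog mdeg k) v)).
  by split=> [|j]; [apply: AR_pihomog hg gv | rewrite mxE pihomogP].
by apply: contra_neq vk0 => /rowP/(_ i); rewrite !mxE.
Qed.

(* Removing the prime factors of [q] one at a time: such a factor divides [p]
   or all entries of [w], and the latter would give a syzygy of too low degree. *)
Lemma mdr_proportional d r g (p q : S) u w : g \is d.-homog -> is_mdr g r ->
  AR g w -> w != 0 -> (forall i, (msize (w 0%R i) <= r.+1)%N) ->
  q != 0 -> q *: u = p *: w -> exists k : S, u = k *: w.
Proof.
move=> hg mdr_r gw w0 wr q0; have [c [s [cU sP ->]]] := @mpoly_factorial K 3 q q0.
elim: s sP p => [_ p|e s IHs sP p].
  rewrite big_nil mulr1 => ue; exists (c^-1 * p).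
  by rewrite -scalerA -ue scalerA mulVr // scale1r.
rewrite big_cons mulrCA => ue.
have [e0 eU eP] : prime_elt e by apply: sP; rewrite mem_head.
have {}IHs := IHs (fun e' es => sP e' (@mem_behead _ (e :: s) e' es)).
have pw i : e * (c * (\prod_(j <- s) j) * u 0 i) = p * w 0 i.
  by have /rowP/(_ i) := ue; rewrite !mxE => <-; ring.
have [[k pk]|Np] := pselect (rdvd e p).
  apply: (IHs k); apply/rowP => i; rewrite !mxE; apply: (mulfI e0).
  by rewrite pw pk; ring.
have /choice[w' w'E] (i : 'I_3) : rdvd e (w 0 i).
  have [|//|//] := eP p (w 0 i).
  by exists (c * (\prod_(j <- s) j) * u 0 i); rewrite -pw mulrC.
have [i wi] := nonzero_entry w0.
have w'i : w' i != 0 by apply: contra_neq wi => w'i; rewrite w'E w'i mul0r.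
have gw' : AR g (\row_j w' j).
  apply: (mulfI e0); rewrite mulr0 -[RHS]gw !mxE !w'E; ring.
have := mdr_lt_msize (i := i) hg mdr_r gw'; rewrite mxE => /(_ w'i).
have := wr i; rewrite w'E msizeM //.
have : msize e != 1%N by rewrite -unit_msize.
rewrite (mpolySpred _ e0) (mpolySpred _ w'i) addSn /= => e1 le lt.
by exfalso; lia.
Qed.

(** The gradient of [g] is orthogonal to [u] and [v], hence proportional to [cross u v]; pairing
    with the Euler field finds the factor. *)
Lemma triple_product_mderiv d g u v i : g \is d.-homog -> AR g u -> AR g v ->
  triple_product euler u v * mderiv i g = d%:R * g * cross u v 0 i.
Proof.
move=> hg gu gv; rewrite -(along_euler hg).
apply/eqP; rewrite -subr_eq0; apply/eqP.
(* Both sides expand the double cross product of [euler], the gradient of [g] and [cross u v]. *)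
transitivity (cross euler (along v g *: u - along u g *: v) 0 i).
  by elim/ord3_ind: i; rewrite /triple_product /along !mxE /= ?mxE; ring.
rewrite /along gu gv !scale0r subr0.
by elim/ord3_ind: i; rewrite !mxE /= ?mxE; ring.
Qed.

Lemma triple_product_homog m n u v :
  (forall i, u 0 i \is m.-homog) -> (forall i, v 0 i \is n.-homog) ->
  triple_product euler u v \is (1 + (m + n)).-homog.
Proof.
move=> hu hv; have huv i j : u 0 i * v 0 j \is (m + n).-homog.
  exact: dhomogM (hu i) (hv j).
have hX i : ('X_i : S) \is 1.-homog by rewrite dhomogX /= mdeg1.
rewrite /triple_product !mxE /=.
by apply: rpredD; [apply: rpredD|]; apply: (dhomogM (hX _)); apply: rpredB.
Qed.

(** * Saito's criterion *)

Section Saito.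
Variables (d : nat) (g : S).
Hypotheses (d_gt0 : (0 < d)%N) (hg : g \is d.-homog) (g0 : g != 0).
Hypothesis (sqf : forall p, prime_elt p -> ~ rdvd (p ^+ 2) g).

Let d0 : (d%:R : S) != 0.
Proof. by rewrite -mpolyC_nat mpolyC_eq0 pnatr_eq0 -lt0n. Qed.

Lemma triple_product_rdvd u v : AR g u -> AR g v ->
  rdvd g (triple_product euler u v).
Proof.
move=> gu gv; apply: squarefree_rdvd => // i.
by rewrite (triple_product_mderiv i hg gu gv); exists (d%:R * cross u v 0 i); ring.
Qed.

(** If the determinant vanished, so would [cross u v], whence [u 0 i *: v = v 0 i *: u] for every
    [i]. *)
Lemma triple_product_neq0 u v : AR g u -> AR g v -> v != 0 ->
  (forall p q, q != 0 -> p *: v <> q *: u) -> triple_product euler u v != 0.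
Proof.
move=> gu gv v0 indep; apply/eqP => W0.
have cr0 i : cross u v 0 i = 0.
  have := triple_product_mderiv i hg gu gv; rewrite W0 mul0r => /esym/eqP.
  by rewrite !mulf_eq0 (negbTE d0) (negbTE g0) => /eqP.
have [i vi] := nonzero_entry v0; apply: (indep (u 0 i) _ vi).
move: (cr0 ix) (cr0 iy) (cr0 iz); rewrite !mxE /= => /subr0_eq ex /subr0_eq ey /subr0_eq ez.
apply/rowP => j; rewrite !mxE [RHS]mulrC => {vi}.
move: i j; elim/ord3_ind; elim/ord3_ind; rewrite ?ex ?ey ?ez //.
Qed.

(** Three vectors orthogonal to a nonzero gradient are dependent. Concretely, the Cramer expansion
    of [euler] in [u], [v], [w] is paired with the gradient. *)
Lemma triple_product_AR0 u v w : AR g u -> AR g v -> AR g w ->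
  triple_product u v w = 0.
Proof.
move=> gu gv gw; apply: (mulIf (mulf_neq0 d0 g0)); rewrite mul0r -(along_euler hg).
transitivity (along u g * triple_product euler v w
    + along v g * triple_product euler w u + along w g * triple_product euler u v).
  by rewrite /triple_product /along !mxE /= ?mxE; ring.
by rewrite /along gu gv gw !mul0r !addr0.
Qed.

(** Cramer's rule expands a syzygy [w] in [euler], [u], [v] over the determinant [c%:MP * g]: the
    coefficient of [euler] is zero, and the other two numerators are divisible by [g]. *)
Lemma saito_free m n u v c : AR_deg g m u -> AR_deg g n v -> c != 0 ->
  triple_product euler u v = c%:MP * g -> free_curve g.
Proof.
move=> [gu hu] [gv hv] c0 W.
have cg0 : c%:MP * g != 0 by rewrite mulf_neq0 // mpolyC_eq0.
exists 2, (fun i : 'I_2 => nth 0%N [:: m; n] i), (fun i : 'I_2 => nth 0 [:: u; v] i).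
split=> [|w gw|q].
- by case=> -[|[|//]] lti /=.
- have [a aE] := triple_product_rdvd gw gv.
  have [b bE] := triple_product_rdvd gu gw.
  exists (fun i : 'I_2 => nth 0 [:: (c^-1)%:MP * a; (c^-1)%:MP * b] i).
  rewrite (eq_bigl xpredT) => [|i]; last by rewrite inE.
  rewrite !big_ord_recl big_ord0 addr0 /=; apply/rowP => i; apply: (mulfI cg0).
  have cK : c%:MP * (c^-1)%:MP = 1 :> S by rewrite -mpolyCM divff.
  rewrite -{1}W !mxE; transitivity (triple_product euler w v * u 0 i
      + triple_product euler u w * v 0 i + triple_product w u v * euler 0 i).
    by elim/ord3_ind: i; rewrite /triple_product !mxE /= ?mxE; ring.
  rewrite (triple_product_AR0 gw gu gv) aE bE mul0r addr0.
  transitivity ((c%:MP * (c^-1)%:MP) * (a * g * u 0 i + b * g * v 0 i)); last by ring.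
  by rewrite cK mul1r.
rewrite !big_ord_recl big_ord0 addr0 /= => q0.
(* Putting the relation into one slot of the determinant isolates one coefficient. *)
have q1 : q ord0 * (c%:MP * g) = 0.
  rewrite -W; transitivity (triple_product euler 0 v).
    by rewrite -q0 /triple_product !mxE /= ?mxE; ring.
  by rewrite /triple_product !mxE /= ?mxE; ring.
have q2 : q (lift ord0 ord0) * (c%:MP * g) = 0.
  rewrite -W; transitivity (triple_product euler u 0).
    by rewrite -q0 /triple_product !mxE /= ?mxE; ring.
  by rewrite /triple_product !mxE /= ?mxE; ring.
move=> i; case: (unliftP ord0 i) => [j ->|->].
  by rewrite (ord1 j); apply: (mulIf cg0); rewrite mul0r.
by apply: (mulIf cg0); rewrite mul0r.
Qed.

End Saito.
End JacobianSyzygies.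

(** The degree [k] part of any combination is taken; generators of degree above [k] contribute
    nothing to it. *)
Lemma homogeneous_combination (K : fieldType) d (g : {mpoly K[3]}) m (ds : 'I_m -> nat)
    (e : 'I_m -> 'rV[{mpoly K[3]}]_3) k v :
  g \is d.-homog -> (forall i, AR_deg g (ds i) (e i)) -> generates_AR g e setT ->
  AR_deg g k v -> exists q : 'I_m -> {mpoly K[3]}, v = \sum_(i | (ds i <= k)%N) q i *: e i.
Proof.
move=> hg ge gen [gv hv]; have [q vE] := gen v gv.
exists (fun i => pihomog mdeg (k - ds i) (q i)); apply/rowP => j.
rewrite -(pihomog_dE (hv j)) vE !summxE raddf_sum [RHS]big_mkcond /=.
apply: eq_big => [i|i _]; first by rewrite inE.
by rewrite !mxE (pihomogM _ _ ((ge i).2 j)); case: ifP.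
Qed.

(** * Adding a line *)

Section AddLine.
Variables (K : numFieldType) (d1 : nat) (f1 : {mpoly K[3]}) (s t : K).
Local Notation S := {mpoly K[3]}.
Local Notation l := (line s t).
Local Notation f := (l * f1).
Local Notation E := (euler K).
Implicit Types (h p q : S) (v : 'rV[S]_3).

(** The value of the vector field [v] on the form [l], as [along_line] confirms. *)
Definition on_line v : S := s *: v 0 iy + t *: v 0 iz.

Lemma on_line_lin p q (u v : 'rV[S]_3) :
  on_line (p *: u + q *: v) = p * on_line u + q * on_line v.
Proof. by rewrite /on_line !mxE -!mul_mpolyC; ring. Qed.

Lemma on_line_scale p v : on_line (p *: v) = p * on_line v.
Proof. by rewrite /on_line !mxE -!mul_mpolyC; ring. Qed.

Lemma on_line_euler : on_line E = l.
Proof. by rewrite /on_line !mxE. Qed.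

Lemma mderivXU (i j : 'I_3) : mderiv i ('X_j : S) = (i == j)%:R.
Proof.
rewrite mderivX mnm1E eq_sym; case: eqP => [->|_]; last by rewrite scale0r.
rewrite (_ : (U_(j) - U_(j) = 0)%MM) ?mpolyX0 ?scale1r //.
by apply/mnmP => k; rewrite mnmBE subnn mnm0E.
Qed.

Lemma along_line v : along v l = on_line v.
Proof.
rewrite /along /line !mderivD !mderivZ !mderivXU /= /on_line -!mul_mpolyC.
by ring.
Qed.

Lemma line_homog : l \is 1.-homog.
Proof. by rewrite rpredD // rpredZ // dhomogX /= mdeg1. Qed.

Lemma on_line_homog k v : (forall i, v 0 i \is k.-homog) -> on_line v \is k.-homog.
Proof. by move=> hv; rewrite rpredD // rpredZ. Qed.

Hypotheses (f1_red : reduced_curve d1 f1) (st0 : (s, t) != (0, 0)).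
Hypothesis l_f1 : ~ divides l f1.

Let d1_gt0 : (0 < d1)%N. Proof. by case: f1_red. Qed.
Let hf1 : f1 \is d1.-homog. Proof. by case: f1_red. Qed.
Let f1_neq0 : f1 != 0. Proof. by case: f1_red => _ _ []. Qed.

Let nat_neq0 n : (0 < n)%N -> (n%:R : S) != 0.
Proof. by move=> n0; rewrite -mpolyC_nat mpolyC_eq0 pnatr_eq0 -lt0n. Qed.

Lemma line_neq0 : l != 0.
Proof.
apply: contraNneq st0 => l0; apply/eqP; congr pair; apply/eqP.
  have /eqP := congr1 (mderiv iy) l0.
  by rewrite mderivD !mderivZ !mderivXU mderiv0 scaler0 addr0 scaler_eq0 oner_eq0 orbF.
have /eqP := congr1 (mderiv iz) l0.
by rewrite mderivD !mderivZ !mderivXU mderiv0 scaler0 add0r scaler_eq0 oner_eq0 orbF.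
Qed.

Lemma line_prime : prime_elt l.
Proof.
have l0 := line_neq0; have szl := msize_homog l0 line_homog.
apply: irred_prime; first exact: mpoly_factorial.
split=> // [|a b lE]; first by rewrite unit_msize // szl.
have [a0 b0] : a != 0 /\ b != 0 by apply/andP; rewrite -negb_or -mulf_eq0 -lE.
move: szl; rewrite lE msizeM // !unit_msize // (mpolySpred _ a0) (mpolySpred _ b0).
by rewrite addSn addnS !eqSS /= => -[]; case: (_.-1) => [|k] //=; [left|right; lia].
Qed.

Lemma f_homog : f \is d1.+1.-homog.
Proof. exact: dhomogM line_homog hf1. Qed.

Lemma f_neq0 : f != 0.
Proof. by rewrite mulf_neq0 // line_neq0. Qed.

Lemma f_squarefree p : prime_elt p -> ~ rdvd (p ^+ 2) f.
Proof.
move=> [p0 pU pP] [h hE]; have [_ lU lP] := line_prime.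
(* If [p] divides the prime [l], the two are associate and [l] would divide [f1]; otherwise both
   factors [p] go into [f1]. *)
have [[m lE]|Npl] := pselect (rdvd p l).
  have [|[k mE]|[k pE]] := lP m p; first by exists 1; rewrite mul1r.
    case/negP: pU; apply/unitrPr; exists k; apply: (mulfI line_neq0).
    by rewrite mulr1 [RHS]lE mE; ring.
  apply: l_f1; exists (h * k ^+ 2); apply: (mulfI line_neq0).
  by rewrite hE pE; ring.
have [|//|[m f1E]] := pP l f1; first by exists (h * p); rewrite hE; ring.
have [|//|[k mE]] := pP l m.
  by exists h; apply: (mulIf p0); rewrite -mulrA -f1E hE; ring.
case: f1_red => _ _ [_ /(_ p) sqf]; case/negP: pU; apply: sqf.
by exists k; rewrite f1E mE; ring.
Qed.

(** The product rule turns [along v f = 0] into [on_line v * f1 = - l * along v f1], and the prime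
    [l] does not divide [f1]. *)
Lemma AR_on_line v : AR f v -> rdvd l (on_line v).
Proof.
move=> fv; have : rdvd l (on_line v * f1).
  have := along_mul v l f1; rewrite {1}/along fv along_line => /esym/eqP.
  by rewrite addr_eq0 => /eqP ->; exists (- along v f1); ring.
by have [_ _ lP] := line_prime; case/lP.
Qed.

(* [AR f] is isomorphic to the submodule of those [v] in [AR f1] for which [l]
   divides [on_line v], by adding a multiple of the Euler field; the integer
   factors below avoid dividing by [d1] and [d1.+1]. *)
Lemma AR_lift v h : AR f1 v -> on_line v = h * l ->
  AR f (d1.+1%:R *: v + (- h) *: E).
Proof.
move=> f1v vl; rewrite ARE along_lin along_mul along_line vl.
by rewrite (along_euler f_homog) [along v f1]f1v; ring.
Qed.

Lemma AR_drop v h : AR f v -> on_line v = h * l ->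
  AR f1 (d1%:R *: v + h *: E).
Proof.
move=> fv vl; rewrite ARE along_lin (along_euler hf1).
apply: (mulfI line_neq0); rewrite mulr0.
have := along_mul v l f1; rewrite [along v f]fv along_line vl => fE.
transitivity (d1%:R * (h * l * f1 + l * along v f1)); first by ring.
by rewrite -fE mulr0.
Qed.

(** Here [h] is homogeneous of degree [k - 1]; the factor ['X_i] lets the statement cover [k = 0],
    where [h = 0]. *)
Lemma homog_mul_line h k i : h * l \is k.-homog -> h * 'X_i \is k.-homog.
Proof.
move=> hl; have := pihomog_dE hl; rewrite (pihomogM _ _ line_homog).
case: ifP => [k_gt0 /(mulIf line_neq0) <-|_ /esym/eqP].
  rewrite -(subnK k_gt0) dhomogM ?pihomogP //; last by rewrite dhomogX /= mdeg1.
  by rewrite subnK // pihomogP.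
by rewrite mulf_eq0 (negbTE line_neq0) orbF => /eqP ->; rewrite mul0r rpred0.
Qed.

Lemma natr_homog n k p : p \is k.-homog -> n%:R * p \is k.-homog.
Proof. by move=> hp; rewrite mulr_natl rpredMn. Qed.

Lemma AR_deg_lift k v h : AR_deg f1 k v -> on_line v = h * l ->
  AR_deg f k (d1.+1%:R *: v + (- h) *: E).
Proof.
move=> [f1v hv] vl; split=> [|i]; first exact: AR_lift.
rewrite !mxE mulNr rpredB ?natr_homog //.
by apply: homog_mul_line; rewrite -vl; apply: on_line_homog.
Qed.

Lemma AR_deg_drop k v h : AR_deg f k v -> on_line v = h * l ->
  AR_deg f1 k (d1%:R *: v + h *: E).
Proof.
move=> [fv hv] vl; split=> [|i]; first exact: AR_drop.
rewrite !mxE rpredD ?natr_homog //.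
by apply: homog_mul_line; rewrite -vl; apply: on_line_homog.
Qed.

Lemma scale_nat_eq0 n v : (0 < n)%N -> n%:R *: v = 0 -> v = 0.
Proof.
move=> n0 /rowP nv; apply/rowP => i; apply: (mulfI (nat_neq0 n0)).
by have := nv i; rewrite !mxE mulr0.
Qed.

(** The lifted field takes the value [d1%:R * h * l] on [l]. If it were zero, [h] and then [v] would
    vanish. *)
Lemma lift_neq0 v h : on_line v = h * l -> v != 0 ->
  d1.+1%:R *: v + (- h) *: E != 0.
Proof.
move=> vl; apply: contra_neq => ev.
have : d1%:R * (h * l) = 0.
  transitivity (on_line (d1.+1%:R *: v + (- h) *: E)).
    by rewrite on_line_lin vl on_line_euler; ring.
  by rewrite ev /on_line !mxE !scaler0 addr0.
move/eqP; rewrite !mulf_eq0 (negbTE line_neq0) (negbTE (nat_neq0 d1_gt0)) orbF => /eqP h0.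
by move: ev; rewrite h0 oppr0 scale0r addr0; apply: scale_nat_eq0.
Qed.

Lemma drop_neq0 v h : on_line v = h * l -> v != 0 -> d1%:R *: v + h *: E != 0.
Proof.
move=> vl; apply: contra_neq => ev.
have : d1.+1%:R * (h * l) = 0.
  transitivity (on_line (d1%:R *: v + h *: E)).
    by rewrite on_line_lin vl on_line_euler; ring.
  by rewrite ev /on_line !mxE !scaler0 addr0.
move/eqP; rewrite !mulf_eq0 (negbTE line_neq0) (negbTE (nat_neq0 (ltn0Sn d1))) orbF => /eqP h0.
by move: ev; rewrite h0 scale0r addr0; apply: scale_nat_eq0.
Qed.

(** * Comparing the minimal degrees of [f1] and [f] *)

Section Compare.
Variables (r1 r : nat) (v1 : 'rV[S]_3).
Hypotheses (mdr_f1 : is_mdr f1 r1) (mdr_f : is_mdr f r).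
Hypotheses (f1v1 : AR_deg f1 r1 v1) (v1_neq0 : v1 != 0).

Lemma mdr_le_add_line : (r1 <= r)%N.
Proof.
have [[v fv v0] _] := mdr_f; have [h vl] := AR_on_line fv.1.
by case: mdr_f1 => _; apply; [apply: AR_deg_drop fv vl | apply: drop_neq0].
Qed.

Lemma mdr_add_line_dvd : rdvd l (on_line v1) -> r = r1.
Proof.
case=> h v1l; apply/eqP; rewrite eqn_leq mdr_le_add_line andbT.
by case: mdr_f => _; apply; [apply: AR_deg_lift f1v1 v1l | apply: lift_neq0].
Qed.

Hypothesis l_v1 : ~ rdvd l (on_line v1).

(** The lift of [l *: v1] to [AR f], with [h = on_line v1]. *)
Definition lift_mul_line : 'rV[S]_3 := d1.+1%:R *: (l *: v1) + (- on_line v1) *: E.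

Lemma AR_lift_mul_line : AR_deg f r1.+1 lift_mul_line.
Proof.
apply: AR_deg_lift; last by rewrite on_line_scale mulrC.
case: f1v1 => gv hv; split=> [|i].
  have := along_lin l 0 v1 0 f1; rewrite scaler0 addr0 mul0r addr0.
  by rewrite [along v1 f1]gv mulr0.
by rewrite mxE; apply: (dhomogM line_homog (hv i)).
Qed.

Lemma lift_mul_line_neq0 : lift_mul_line != 0.
Proof.
apply: lift_neq0; first by rewrite on_line_scale mulrC.
have [i vi] := nonzero_entry v1_neq0.
by apply: contra_neq vi => /rowP/(_ i)/eqP; rewrite !mxE mulf_eq0 (negbTE line_neq0) => /eqP.
Qed.

Lemma mdr_add_line_le : (r <= r1.+1)%N.
Proof. by case: mdr_f => _; apply; [apply: AR_lift_mul_line | apply: lift_mul_line_neq0]. Qed.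

Hypothesis r_eq : r = r1.

Lemma lift_mul_line_indep v p q : AR_deg f r v -> v != 0 -> q != 0 ->
  p *: v <> q *: lift_mul_line.
Proof.
move=> fv v0 q0 pq; have [h vl] := AR_on_line fv.1.
(* Evaluate the supposed relation on [l] and cancel [l]. *)
have ph : p * h = q * (d1%:R * on_line v1).
  have := congr1 on_line pq; rewrite !on_line_scale on_line_lin on_line_scale.
  rewrite on_line_euler vl => e; apply: (mulIf line_neq0).
  by rewrite -mulrA e; ring.
pose w := d1%:R *: v + h *: E.
have fw : AR_deg f1 r1 w by rewrite -r_eq; apply: AR_deg_drop.
have w0 : w != 0 by apply: drop_neq0.
(* Combining [pq] with [ph] eliminates the Euler field and leaves a proportionality between [v1] and
   [w]. *)
have [|||k v1E] := mdr_proportional (q := q * d1%:R * d1.+1%:R * l) (p := p) (u := v1)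
  hf1 mdr_f1 fw.1 w0.
- move=> i; have [->|wi] := eqVneq (w 0 i) 0; first by rewrite msize0.
  by rewrite (msize_homog wi (fw.2 i)).
- by rewrite !mulf_neq0 ?line_neq0 ?nat_neq0.
- apply/rowP => i; have /rowP/(_ i) := pq; rewrite !mxE => pqi.
  transitivity (d1%:R * (p * v 0 i) + (p * h) * 'X_i); last by ring.
  by rewrite pqi ph; ring.
apply: l_v1; rewrite v1E on_line_scale on_line_lin vl on_line_euler.
by exists (k * (d1%:R * h + h)); ring.
Qed.

(** The size bound matters: beyond the list [nth] returns 0, which would satisfy the inequality
    trivially. *)
Lemma second_generator_degree ds : min_gen_degrees f ds ->
  (1 < size ds)%N /\ (nth 0%N ds 1 <= r.+1)%N.
Proof.
move=> [ds_sorted [e [fe gen _]]]; apply/andP; apply: contrapT => Nds.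
have small (i : 'I_(size ds)) : (nth 0%N ds i <= r.+1)%N -> i = 0%N :> nat.
  move=> le_i; apply/eqP; rewrite -leqn0 leqNgt; apply/negP => i_gt0.
  have sz : (1 < size ds)%N := leq_ltn_trans i_gt0 (ltn_ord i).
  apply: Nds; rewrite sz (leq_trans _ le_i) //.
  by apply: (sorted_leq_nth leq_trans leqnn); rewrite ?inE.
(* With at most one generator of degree up to [r.+1], all syzygies in these degrees are multiples of
   a single [e0], taken to be 0 if there is no such generator. *)
have [e0 e0P] : exists e0, forall k v, (k <= r.+1)%N -> AR_deg f k v ->
    exists p, v = p *: e0.
  case: (pickP (fun i : 'I_(size ds) => nth 0%N ds i <= r.+1)%N) => [i0 le_i0|none].
    exists (e i0) => k v le_k fv.
    have [q ->] := homogeneous_combination f_homog fe gen fv.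
    exists (if (nth 0%N ds i0 <= k)%N then q i0 else 0).
    rewrite big_mkcond (bigD1 i0) //= big1 ?addr0; first by case: ifP; rewrite ?scale0r.
    move=> i ne; case: ifP => // le_i; case/eqP: ne; apply: val_inj.
    by rewrite /= (small i0 le_i0) (small i (leq_trans le_i le_k)).
  exists 0 => k v le_k fv; exists 0; rewrite scaler0.
  have [q ->] := homogeneous_combination f_homog fe gen fv.
  by rewrite big_pred0 // => i; apply/negP => le_i; have := none i; rewrite /= (leq_trans le_i).
have [[v fv v0] _] := mdr_f.
have [p vE] := e0P r v (leqnSn r) fv.
have [|q wE] := e0P r1.+1 lift_mul_line _ AR_lift_mul_line; first by rewrite r_eq.
apply: (lift_mul_line_indep (p := q) (q := p) fv v0).
  by apply: contra_neq v0 => p0; rewrite vE p0 scale0r.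
by rewrite vE wE !scalerA mulrC.
Qed.

Lemma degree_bound : (d1 <= (2 * r1).+1)%N /\ (d1 = (2 * r1).+1 -> free_curve f).
Proof.
have [[v fv v0] _] := mdr_f.
set w := lift_mul_line; have fw : AR_deg f r1.+1 w := AR_lift_mul_line.
have hW : triple_product E w v \is (1 + (r1.+1 + r)).-homog.
  exact: triple_product_homog fw.2 fv.2.
have W0 : triple_product E w v != 0.
  apply: (triple_product_neq0 (ltn0Sn d1) f_homog f_neq0 fw.1 fv.1 v0) => p q q0.
  exact: lift_mul_line_indep.
have [k WE] := triple_product_rdvd f_homog f_neq0 f_squarefree fw.1 fv.1.
have k0 : k != 0 by apply: contra_neq W0 => k0; rewrite WE k0 mul0r.
(* Comparing degrees, [k] has degree [2 * r1 + 1 - d1]; in the extremal case it is a constant. *)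
have := msizeM k0 f_neq0; rewrite -WE (msize_homog W0 hW) (msize_homog f_neq0 f_homog).
have := mpolySpred mdeg k0; move: (mmeasure mdeg k).-1 => j szk; rewrite szk r_eq => sz.
split=> [|d1E]; first by lia.
have j0 : j = 0%N by lia.
have /msize_poly1P[c c0 kE] : msize k == 1%N by rewrite szk j0.
by apply: (saito_free (ltn0Sn d1) f_homog f_neq0 f_squarefree fw fv c0); rewrite WE kE.
Qed.

End Compare.
End AddLine.

Theorem theorem3p3 (R : realType) (d1 r1 r : nat)
  (f1 a1 b1 c1 : {mpoly (complex R)[3]}) (s t : complex R) (ds : seq nat) :
  let l := line s t in
  let f := l * f1 in
  reduced_curve d1 f1 ->
  is_mdr f1 r1 ->
  AR_deg f1 r1 (triple a1 b1 c1) ->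
  triple a1 b1 c1 != 0 ->
  (s, t) != (0, 0) ->
  ~ divides l f1 ->
  is_mdr f r ->
  min_gen_degrees f ds ->
  let case1 := r = r1.+1 in
  let case2 := [/\ r = r1, (1 < size ds)%N & (nth 0%N ds 1 <= r.+1)%N] in
  (divides l (s *: b1 + t *: c1) -> r = r1) /\
  (~ divides l (s *: b1 + t *: c1) ->
     (case1 \/ case2) /\
     ((2 * r1 < d1 - 1)%N \/ ((2 * r1 = d1 - 1)%N /\ ~ free_curve f) ->
        ~ case2)).
Proof.
move=> l f red mdr1 f1v v0 st l_f1 mdrf gens case1 case2.
have lE : on_line s t (triple a1 b1 c1) = s *: b1 + t *: c1.
  by rewrite /on_line !mxE.
rewrite -lE; split=> [|Nl]; first exact: (mdr_add_line_dvd red st l_f1 mdr1 mdrf f1v v0).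
(* Positivity makes the truncated [d1 - 1] a true difference, so [2 * r1 = d1 - 1] yields
   [d1 = (2 * r1).+1]. *)
have d1_gt0 : (0 < d1)%N by case: red.
split.
  have le_r := mdr_le_add_line red st l_f1 mdr1 mdrf.
  have := mdr_add_line_le red st mdrf f1v v0.
  rewrite leq_eqVlt => /predU1P[|lt_r]; [by left | right].
  have r_eq : r = r1 by apply/eqP; rewrite eqn_leq -ltnS lt_r.
  have [sz le2] := second_generator_degree red st l_f1 mdr1 mdrf f1v Nl r_eq gens.
  by split.
move=> cond [r_eq _ _].
have [le_d freeP] := degree_bound red st l_f1 mdr1 mdrf f1v v0 Nl r_eq.
by case: cond => [|[eq_d /(_ (freeP _))]]; [lia | apply; lia].
Qed.
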